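(* Let $\{X_i:i\in I\}$ and $\{Y_j:j\in J\}$ be families of real Banach spaces, let $X=\left(\bigoplus_{i\in I}X_i\right)_{\ell_1}$ and $Y=\left(\bigoplus_{j\in J}Y_j\right)_{\ell_\infty}$, and let $D$ be a bounded closed convex subset of $B_X$. For $i\in I$ let $E_i:X_i\to X$ be the natural isometric embedding, $P_i:X\to X_i$ the canonical norm-one projection, and $D_i=\overline{P_i(D)}\subset X_i$ (norm closure in $X_i$). Suppose that $D=\overline{\mathrm{co}}\left(\bigcup_{i\in I}E_iD_i\right)$. If the pair $(X,Y)$ has the Bishop-Phelps-Bollobás property on $D$ with a function $\epsilon\mapsto\eta_D(\epsilon)$, then the pair $(X_i,Y_j)$ has the Bishop-Phelps-Bollobás property on $D_i$ for every $i\in I$ and every $j\in J$. More precisely, for $0<\epsilon<1$, $$\eta_D(X,Y)(\epsilon)\leq\eta_{D_i}(X_i,Y_j)(\epsilon)\qquad(i\in I,\ j\in J).$$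
   Context: All Banach spaces are over $\mathbb{R}$; $B_X$ is the closed unit ball of $X$; $\overline{\mathrm{co}}$ is the closed convex hull; $\mathcal{L}(X,Y)$ is the Banach space of bounded linear operators with operator norm $\|\cdot\|$. For a bounded closed convex set $D\subset X$ and $T\in\mathcal{L}(X,Y)$, $\|T\|_D=\sup\{\|Tx\|:x\in D\}$. The pair $(X,Y)$ has the Bishop-Phelps-Bollobás property on $D$ (with the function $\eta_D$) if for every $\epsilon>0$ there is $\eta_D(\epsilon)>0$ such that for every $T\in\mathcal{L}(X,Y)$ with $\|T\|_D=1$ and every $x\in D$ with $\|T(x)\|>1-\eta_D(\epsilon)$, there exist $S\in\mathcal{L}(X,Y)$ and $z\in D$ such that $\|S(z)\|=1=\|S\|_D$, $\|x-z\|<\epsilon$ and $\|T-S\|<\epsilon$. For Banach spaces $X,Y$ and a bounded closed convex $D\subseteq B_X$, put $$\Pi_D(X,Y)=\{(x,T):x\in D,\ T\in\mathcal{L}(X,Y),\ \|T(x)\|=\|T\|_D=1\},$$ $$\eta_D(X,Y)(\epsilon)=\inf\{1-\|Tx\|:x\in D,\ T\in\mathcal{L}(X,Y),\ \|T\|_D=1,\ \mathrm{dist}((x,T),\Pi_D(X,Y))\geq\epsilon\},$$ where $\mathrm{dist}((x,T),\Pi_D(X,Y))=\inf\{\max\{\|x-y\|,\|T-S\|\}:(y,S)\in\Pi_D(X,Y)\}$, with the usual convention $\inf\emptyset=+\infty$. *)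

(* Defs.v *)
From HB Require Import structures.
From mathcomp Require Import all_boot all_order all_algebra finmap.
From mathcomp Require Import all_classical all_reals all_analysis.

Set Implicit Arguments.
Unset Strict Implicit.
Unset Printing Implicit Defensive.

Import Order.TTheory GRing.Theory Num.Theory.
Import numFieldNormedType.Exports.

Local Open Scope classical_set_scope.
Local Open Scope ring_scope.

Definition unit_ball (R : realType) (X : normedModType R) : set X :=
  [set x | `|x| <= 1].
Arguments unit_ball {R} X.

(* ||T||_D = sup {||T x|| : x in D}; this is 0 when D is empty. *)
Definition norm_on (R : realType) (X Y : normedModType R) (D : set X)
    (T : X -> Y) : R :=
  sup [set `|T x| | x in D].

Section sup_facts.
Variables (R : realType) (T : Type) (A : set T).
Implicit Types f : T -> R.

Lemma sup_image_ub f M x : (forall y, A y -> f y <= M) -> A x ->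
  f x <= sup [set f y | y in A].
Proof.
move=> fM Ax; apply: ub_le_sup; last by exists x.
by exists M => _ [y Ay <-]; exact: fM.
Qed.

Lemma sup_image_le f M : 0 <= M -> (forall y, A y -> f y <= M) ->
  sup [set f y | y in A] <= M.
Proof.
move=> M0 fM; have [->|/set0P[x Ax]] := eqVneq A set0.
  by rewrite image_set0 sup0.
apply: ge_sup; first by exists (f x); exists x.
by move=> _ [y Ay <-]; exact: fM.
Qed.

Lemma sup_image_ge0 f : (forall y, 0 <= f y) -> 0 <= sup [set f y | y in A].
Proof.
move=> f0; have [supf|/sup_out ->//] := pselect (has_sup [set f y | y in A]).
have [[_ [x Ax _]] _] := supf.
by rewrite (le_trans (f0 x))// ub_le_sup//; [exact: supf.2|exists x].
Qed.

End sup_facts.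

Section bounded_operators.
Variables (R : realType) (X Y : normedModType R).

Record blop := Blop {
  blop_fun :> X -> Y ;
  blop_linear : linear blop_fun ;
  blop_bounded : exists M, forall x, `|blop_fun x| <= M * `|x|
}.

HB.instance Definition _ (T : blop) :=
  GRing.isLinear.Build R X Y *:%R (blop_fun T) (@blop_linear T).

HB.instance Definition _ := gen_eqMixin blop.
HB.instance Definition _ := gen_choiceMixin blop.

Lemma blop_ext (S T : blop) : S =1 T -> S = T.
Proof.
case: S T => [f f1 f2] [g g1 g2] /= /funext fg; move: f1 f2; rewrite fg.
by move=> f1 f2; congr Blop; exact: Prop_irrelevance.
Qed.

Fact blop0_linear : linear (\0 : X -> Y).
Proof. by move=> a x y; rewrite /= scaler0 addr0. Qed.
Fact blop0_bounded : exists M : R, forall x, `|(\0 : X -> Y) x| <= M * `|x|.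
Proof. by exists 0 => x; rewrite normr0 mul0r. Qed.
Definition blop0 := Blop blop0_linear blop0_bounded.

Fact bloN_linear (T : blop) : linear (\- T).
Proof. by move=> a x y; rewrite /= linearP opprD scalerN. Qed.
Fact bloN_bounded (T : blop) : exists M, forall x, `|(\- T) x| <= M * `|x|.
Proof. by have [M TM] := blop_bounded T; exists M => x; rewrite normrN. Qed.
Definition blop_opp T := Blop (bloN_linear T) (bloN_bounded T).

Fact bloD_linear (S T : blop) : linear (S \+ T).
Proof. by move=> a x y; rewrite /= !linearP scalerDr addrACA. Qed.
Fact bloD_bounded (S T : blop) : exists M, forall x, `|(S \+ T) x| <= M * `|x|.
Proof.
have [M SM] := blop_bounded S; have [N TN] := blop_bounded T.
by exists (M + N) => x; rewrite mulrDl (le_trans (ler_normD _ _))// lerD.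
Qed.
Definition blop_add S T := Blop (bloD_linear S T) (bloD_bounded S T).

Fact bloZ_linear (c : R) (T : blop) : linear (c \*: (T : X -> Y)).
Proof. by move=> a x y; rewrite /= linearP scalerDr !scalerA mulrC. Qed.
Fact bloZ_bounded (c : R) (T : blop) :
  exists M, forall x, `|(c \*: (T : X -> Y)) x| <= M * `|x|.
Proof.
have [M TM] := blop_bounded T; exists (`|c| * M) => x.
by rewrite normrZ -mulrA ler_wpM2l.
Qed.
Definition blop_scale c T := Blop (bloZ_linear c T) (bloZ_bounded c T).

Fact blop_addA : associative blop_add.
Proof. by move=> ? ? ?; apply: blop_ext => x; exact: addrA. Qed.
Fact blop_addC : commutative blop_add.
Proof. by move=> ? ?; apply: blop_ext => x; exact: addrC. Qed.
Fact blop_add0 : left_id blop0 blop_add.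
Proof. by move=> ?; apply: blop_ext => x; exact: add0r. Qed.
Fact blop_addN : left_inverse blop0 blop_opp blop_add.
Proof. by move=> ?; apply: blop_ext => x; exact: addNr. Qed.

HB.instance Definition _ :=
  GRing.isZmodule.Build blop blop_addA blop_addC blop_add0 blop_addN.

Fact blop_scaleA a b T : blop_scale a (blop_scale b T) = blop_scale (a * b) T.
Proof. by apply: blop_ext => x; exact: scalerA. Qed.
Fact blop_scale1 : left_id 1 blop_scale.
Proof. by move=> ?; apply: blop_ext => x; exact: scale1r. Qed.
Fact blop_scaleDr : right_distributive blop_scale +%R.
Proof. by move=> ? ? ?; apply: blop_ext => x; exact: scalerDr. Qed.
Fact blop_scaleDl T : {morph blop_scale^~ T : a b / a + b}.
Proof. by move=> ? ?; apply: blop_ext => x; exact: scalerDl. Qed.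

HB.instance Definition _ := GRing.Zmodule_isLmodule.Build R blop
  blop_scaleA blop_scale1 blop_scaleDr blop_scaleDl.

Definition opnorm (T : blop) : R := norm_on (unit_ball X) T.

Lemma opnorm_ub (T : blop) x : unit_ball X x -> `|T x| <= opnorm T.
Proof.
have [M TM] := blop_bounded T; apply: (sup_image_ub (M := `|M|)) => y y1.
rewrite (le_trans (TM y))// (le_trans (ler_wpM2r _ (ler_norm M)))//.
by rewrite ler_piMr.
Qed.

Lemma opnorm_ge0 (T : blop) : 0 <= opnorm T.
Proof. by apply: sup_image_ge0 => x. Qed.

Fact opnormD (S T : blop) : opnorm (S + T) <= opnorm S + opnorm T.
Proof.
apply: sup_image_le; first by rewrite addr_ge0 ?opnorm_ge0.
move=> x x1; rewrite (le_trans (ler_normD _ _))//.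
by rewrite lerD ?opnorm_ub.
Qed.

Fact opnormZ (c : R) (T : blop) : opnorm (c *: T) = `|c| * opnorm T.
Proof.
have le d (S : blop) : opnorm (d *: S) <= `|d| * opnorm S.
  apply: sup_image_le; first by rewrite mulr_ge0 ?opnorm_ge0.
  by move=> x x1; rewrite normrZ ler_wpM2l ?opnorm_ub.
apply/eqP; rewrite eq_le le /=; have [->|c0] := eqVneq c 0.
  by rewrite normr0 mul0r opnorm_ge0.
rewrite -ler_pdivlMl ?normr_gt0// -normfV.
by rewrite (le_trans _ (le _ _))// scalerA mulVf// scale1r.
Qed.

Fact opnorm_eq0 (T : blop) : opnorm T = 0 -> T = 0.
Proof.
move=> T0; apply: blop_ext => x; have [->|x0] := eqVneq x 0.
  by rewrite !linear0.
have : `|T (`|x|^-1 *: x)| <= 0.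
  rewrite -T0 opnorm_ub// /unit_ball/= normrZ normfV normr_id mulVf//.
  by rewrite normr_eq0.
rewrite normr_le0 linearZ/= scaler_eq0 invr_eq0 normr_eq0 (negbTE x0).
by move=> /eqP.
Qed.

HB.instance Definition _ :=
  Lmodule_isNormed.Build R blop opnormD opnormZ opnorm_eq0.

End bounded_operators.

Section linf_sum.
Variables (R : realType) (J : choiceType) (Y : J -> completeNormedModType R).

Record linf_sum := LinfSum {
  linf_val :> forall j, Y j ;
  linf_bounded : exists M, forall j, `|linf_val j| <= M
}.

HB.instance Definition _ := gen_eqMixin linf_sum.
HB.instance Definition _ := gen_choiceMixin linf_sum.

Lemma linf_ext (x y : linf_sum) : (forall j, x j = y j) -> x = y.
Proof.
case: x y => [f f1] [g g1] /= fg.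
have {}fg : f = g by exact: functional_extensionality_dep.
by move: f1; rewrite fg => f1; congr LinfSum; exact: Prop_irrelevance.
Qed.

Fact linf0_bounded : exists M : R, forall j, `|0 : Y j| <= M.
Proof. by exists 0 => j; rewrite normr0. Qed.
Definition linf0 := LinfSum linf0_bounded.

Fact linfN_bounded (x : linf_sum) : exists M, forall j, `|- x j| <= M.
Proof. by have [M xM] := linf_bounded x; exists M => j; rewrite normrN. Qed.
Definition linf_opp x := LinfSum (linfN_bounded x).

Fact linfD_bounded (x y : linf_sum) : exists M, forall j, `|x j + y j| <= M.
Proof.
have [M xM] := linf_bounded x; have [N yN] := linf_bounded y.
by exists (M + N) => j; rewrite (le_trans (ler_normD _ _))// lerD.
Qed.
Definition linf_add x y := LinfSum (linfD_bounded x y).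

Fact linfZ_bounded (c : R) (x : linf_sum) :
  exists M, forall j, `|c *: x j| <= M.
Proof.
have [M xM] := linf_bounded x; exists (`|c| * M) => j.
by rewrite normrZ ler_wpM2l//; exact: xM.
Qed.
Definition linf_scale c x := LinfSum (linfZ_bounded c x).

Fact linf_addA : associative linf_add.
Proof. by move=> ? ? ?; apply: linf_ext => j; exact: addrA. Qed.
Fact linf_addC : commutative linf_add.
Proof. by move=> ? ?; apply: linf_ext => j; exact: addrC. Qed.
Fact linf_add0 : left_id linf0 linf_add.
Proof. by move=> ?; apply: linf_ext => j; exact: add0r. Qed.
Fact linf_addN : left_inverse linf0 linf_opp linf_add.
Proof. by move=> ?; apply: linf_ext => j; exact: addNr. Qed.

HB.instance Definition _ :=
  GRing.isZmodule.Build linf_sum linf_addA linf_addC linf_add0 linf_addN.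

Fact linf_scaleA a b x : linf_scale a (linf_scale b x) = linf_scale (a * b) x.
Proof. by apply: linf_ext => j; exact: scalerA. Qed.
Fact linf_scale1 : left_id 1 linf_scale.
Proof. by move=> ?; apply: linf_ext => j; exact: scale1r. Qed.
Fact linf_scaleDr : right_distributive linf_scale +%R.
Proof. by move=> ? ? ?; apply: linf_ext => j; exact: scalerDr. Qed.
Fact linf_scaleDl x : {morph linf_scale^~ x : a b / a + b}.
Proof. by move=> ? ?; apply: linf_ext => j; exact: scalerDl. Qed.

HB.instance Definition _ := GRing.Zmodule_isLmodule.Build R linf_sum
  linf_scaleA linf_scale1 linf_scaleDr linf_scaleDl.

Definition linf_norm (x : linf_sum) : R := sup [set `|x j| | j in setT].

Lemma linf_norm_ub (x : linf_sum) j : `|x j| <= linf_norm x.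
Proof.
have [M xM] := linf_bounded x.
exact: (@sup_image_ub _ _ setT (fun j => `|x j|) M j).
Qed.

Lemma linf_norm_le (x : linf_sum) M :
  0 <= M -> (forall j, `|x j| <= M) -> linf_norm x <= M.
Proof. by move=> M0 xM; apply: sup_image_le. Qed.

Lemma linf_norm_ge0 (x : linf_sum) : 0 <= linf_norm x.
Proof. by apply: sup_image_ge0 => j. Qed.

Fact linf_normD (x y : linf_sum) : linf_norm (x + y) <= linf_norm x + linf_norm y.
Proof.
apply: linf_norm_le => [|j]; first by rewrite addr_ge0 ?linf_norm_ge0.
by rewrite (le_trans (ler_normD _ _))// lerD ?linf_norm_ub.
Qed.

Fact linf_normZ (c : R) (x : linf_sum) : linf_norm (c *: x) = `|c| * linf_norm x.
Proof.
have le d (y : linf_sum) : linf_norm (d *: y) <= `|d| * linf_norm y.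
  apply: linf_norm_le => [|j]; first by rewrite mulr_ge0 ?linf_norm_ge0.
  by rewrite normrZ ler_wpM2l ?linf_norm_ub.
apply/eqP; rewrite eq_le le /=; have [->|c0] := eqVneq c 0.
  by rewrite normr0 mul0r linf_norm_ge0.
rewrite -ler_pdivlMl ?normr_gt0// -normfV.
by rewrite (le_trans _ (le _ _))// scalerA mulVf// scale1r.
Qed.

Fact linf_norm_eq0 (x : linf_sum) : linf_norm x = 0 -> x = 0.
Proof.
move=> x0; apply: linf_ext => j; apply/eqP.
by rewrite -normr_le0 -x0 linf_norm_ub.
Qed.

HB.instance Definition _ :=
  Lmodule_isNormed.Build R linf_sum linf_normD linf_normZ linf_norm_eq0.

Fact linf_complete (F : set_system linf_sum) :
  ProperFilter F -> cauchy F -> cvg F.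
Proof.
move=> FF /cauchyP Fc; have cF j : cvg ((x : linf_sum) j @[x --> F]).
  apply: cauchy_cvg; apply/cauchyP => e e0; have [x Fx] := Fc e e0; exists (x j).
  change (F [set y : linf_sum | ball (x j) e (y j)]).
  apply: filterS Fx => y /=; rewrite -!ball_normE/=; apply: le_lt_trans.
  exact: (linf_norm_ub (x - y)).
pose g j := lim ((x : linf_sum) j @[x --> F]).
have gP x e : F (ball x e) -> forall j, `|x j - g j| <= e.
  move=> Fx j; have : `|x j - (y : linf_sum) j| @[y --> F] --> `|x j - g j|.
    by apply: cvg_norm; apply: cvgB; [exact: cvg_cst|exact: cF].
  apply: (@closed_cvg _ _ F FF _ (fun r : R => r <= e)); first exact: closed_le.
  apply: filterS Fx => y; rewrite -ball_normE/= => /ltW; apply: le_trans.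
  exact: (linf_norm_ub (x - y)).
have gb : exists M, forall j, `|g j| <= M.
  have [x Fx] := Fc 1 ltr01; have [M xM] := linf_bounded x.
  exists (M + 1) => j; rewrite -[g j](subKr (x j)).
  by rewrite (le_trans (ler_normB _ _))// lerD//; [exact: xM|exact: gP].
apply/cvg_ex; exists (LinfSum gb); apply/fcvgrPdist_lt => e e0.
have e20 : 0 < e / 2 by rewrite divr_gt0.
have [x Fx] := Fc _ e20; apply: filterS (Fx) => y; rewrite -ball_normE/= => xy.
rewrite (le_lt_trans (ler_distD x _ _))// [ltRHS]splitr ler_ltD// distrC.
by apply: linf_norm_le => [|j]; [exact: ltW|exact: gP].
Qed.

HB.instance Definition _ := Uniform_isComplete.Build linf_sum linf_complete.

End linf_sum.

Section l1_sum.
Variables (R : realType) (I : choiceType) (X : I -> completeNormedModType R).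

Record l1_sum := L1Sum {
  l1_val :> forall i, X i ;
  l1_summable : (\esum_(i in setT) `|l1_val i|%:E < +oo)%E
}.

HB.instance Definition _ := gen_eqMixin l1_sum.
HB.instance Definition _ := gen_choiceMixin l1_sum.

Lemma l1_ext (x y : l1_sum) : (forall i, x i = y i) -> x = y.
Proof.
case: x y => [f f1] [g g1] /= fg.
have {}fg : f = g by exact: functional_extensionality_dep.
by move: f1; rewrite fg => f1; congr L1Sum; exact: Prop_irrelevance.
Qed.

Fact l10_summable : (\esum_(i in setT) `|0 : X i|%:E < +oo :> \bar R)%E.
Proof. by rewrite esum1// => i _; rewrite normr0. Qed.
Definition l10 := L1Sum l10_summable.

Fact l1N_summable (x : l1_sum) : (\esum_(i in setT) `|- x i|%:E < +oo)%E.
Proof.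
rewrite (eq_esum (b := fun i => `|x i|%:E)) ?l1_summable// => i _.
by rewrite normrN.
Qed.
Definition l1_opp x := L1Sum (l1N_summable x).

Fact l1D_esum_le (x y : forall i, X i) : (\esum_(i in setT) `|x i + y i|%:E <=
  \esum_(i in setT) `|x i|%:E + \esum_(i in setT) `|y i|%:E)%E.
Proof.
rewrite -esumD//; apply: le_esum => i _.
by rewrite -EFinD lee_fin ler_normD.
Qed.
Fact l1D_summable (x y : l1_sum) : (\esum_(i in setT) `|x i + y i|%:E < +oo)%E.
Proof.
by rewrite (le_lt_trans (l1D_esum_le _ _))// lte_add_pinfty ?l1_summable.
Qed.
Definition l1_add x y := L1Sum (l1D_summable x y).

Fact l1Z_esum_le (c : R) (x : forall i, X i) :
  (\esum_(i in setT) `|c *: x i|%:E <= `|c|%:E * \esum_(i in setT) `|x i|%:E)%E.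
Proof.
apply: ge_ereal_sup => _ [A [finA _] <-].
under eq_fsbigr do rewrite normrZ EFinM.
rewrite -ge0_mule_fsumr//; apply: lee_wpmul2l => //.
by apply: ereal_sup_ubound; exists A.
Qed.
Fact l1Z_summable (c : R) (x : l1_sum) :
  (\esum_(i in setT) `|c *: x i|%:E < +oo)%E.
Proof.
rewrite (le_lt_trans (l1Z_esum_le _ _))// lte_mul_pinfty ?l1_summable//.
Qed.
Definition l1_scale c x := L1Sum (l1Z_summable c x).

Fact l1_addA : associative l1_add.
Proof. by move=> ? ? ?; apply: l1_ext => i; exact: addrA. Qed.
Fact l1_addC : commutative l1_add.
Proof. by move=> ? ?; apply: l1_ext => i; exact: addrC. Qed.
Fact l1_add0 : left_id l10 l1_add.
Proof. by move=> ?; apply: l1_ext => i; exact: add0r. Qed.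
Fact l1_addN : left_inverse l10 l1_opp l1_add.
Proof. by move=> ?; apply: l1_ext => i; exact: addNr. Qed.

HB.instance Definition _ :=
  GRing.isZmodule.Build l1_sum l1_addA l1_addC l1_add0 l1_addN.

Fact l1_scaleA a b x : l1_scale a (l1_scale b x) = l1_scale (a * b) x.
Proof. by apply: l1_ext => i; exact: scalerA. Qed.
Fact l1_scale1 : left_id 1 l1_scale.
Proof. by move=> ?; apply: l1_ext => i; exact: scale1r. Qed.
Fact l1_scaleDr : right_distributive l1_scale +%R.
Proof. by move=> ? ? ?; apply: l1_ext => i; exact: scalerDr. Qed.
Fact l1_scaleDl x : {morph l1_scale^~ x : a b / a + b}.
Proof. by move=> ? ?; apply: l1_ext => i; exact: scalerDl. Qed.

HB.instance Definition _ := GRing.Zmodule_isLmodule.Build R l1_sum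
  l1_scaleA l1_scale1 l1_scaleDr l1_scaleDl.

Definition l1_norm (x : l1_sum) : R := fine (\esum_(i in setT) `|x i|%:E)%E.

Lemma l1_normE (x : l1_sum) : (l1_norm x)%:E = (\esum_(i in setT) `|x i|%:E)%E.
Proof.
rewrite fineK// ge0_fin_numE; first exact: l1_summable.
exact: esum_ge0.
Qed.

Lemma l1_norm_ge0 (x : l1_sum) : 0 <= l1_norm x.
Proof. by rewrite fine_ge0// esum_ge0. Qed.

Lemma l1_norm_ub (x : l1_sum) i : `|x i| <= l1_norm x.
Proof.
rewrite -lee_fin l1_normE; apply: ereal_sup_ubound.
by exists [set i]; rewrite ?fsbig_set1.
Qed.

Fact l1_normD (x y : l1_sum) : l1_norm (x + y) <= l1_norm x + l1_norm y.
Proof. by rewrite -lee_fin EFinD !l1_normE; exact: l1D_esum_le. Qed.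

Fact l1_normZ (c : R) (x : l1_sum) : l1_norm (c *: x) = `|c| * l1_norm x.
Proof.
have le d (y : l1_sum) : l1_norm (d *: y) <= `|d| * l1_norm y.
  by rewrite -lee_fin EFinM !l1_normE; exact: l1Z_esum_le.
apply/eqP; rewrite eq_le le /=; have [->|c0] := eqVneq c 0.
  by rewrite normr0 mul0r l1_norm_ge0.
rewrite -ler_pdivlMl ?normr_gt0// -normfV.
by rewrite (le_trans _ (le _ _))// scalerA mulVf// scale1r.
Qed.

Fact l1_norm_eq0 (x : l1_sum) : l1_norm x = 0 -> x = 0.
Proof.
move=> x0; apply: l1_ext => i; apply/eqP.
by rewrite -normr_le0 -x0 l1_norm_ub.
Qed.

HB.instance Definition _ :=
  Lmodule_isNormed.Build R l1_sum l1_normD l1_normZ l1_norm_eq0.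

Fact l1_complete (F : set_system l1_sum) :
  ProperFilter F -> cauchy F -> cvg F.
Proof.
move=> FF /cauchyP Fc; have cF i : cvg ((x : l1_sum) i @[x --> F]).
  apply: cauchy_cvg; apply/cauchyP => e e0; have [x Fx] := Fc e e0; exists (x i).
  change (F [set y : l1_sum | ball (x i) e (y i)]).
  apply: filterS Fx => y /=; rewrite -!ball_normE/=; apply: le_lt_trans.
  exact: (l1_norm_ub (x - y)).
pose g i := lim ((x : l1_sum) i @[x --> F]).
have gP x e : F (ball x e) -> (\esum_(i in setT) `|x i - g i|%:E <= e%:E)%E.
  move=> Fx; apply: ge_ereal_sup => _ [A [finA _] <-].
  rewrite fsumEFin// lee_fin fsbig_finite//=.
  have : \sum_(i <- fset_set A) `|x i - (y : l1_sum) i| @[y --> F] -->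
         \sum_(i <- fset_set A) `|x i - g i|.
    apply: cvg_big => [|i _]; first exact: add_continuous.
    by apply: cvg_norm; apply: cvgB; [exact: cvg_cst|exact: cF].
  apply: (@closed_cvg _ _ F FF _ (fun r : R => r <= e)); first exact: closed_le.
  apply: filterS Fx => y; rewrite -ball_normE/= => /ltW; apply: le_trans.
  rewrite -fsbig_finite// -lee_fin -fsumEFin// (l1_normE (x - y)).
  by apply: ereal_sup_ubound; exists A.
have gs : (\esum_(i in setT) `|g i|%:E < +oo)%E.
  have [x Fx] := Fc 1 ltr01.
  have -> : (fun i => `|g i|%:E) = (fun i => `|x i + - (x i - g i)|%:E).
    by apply/funext => i; rewrite subKr.
  rewrite (le_lt_trans (l1D_esum_le _ _))// lte_add_pinfty ?l1_summable//.
  under eq_esum do rewrite normrN.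
  by rewrite (le_lt_trans (gP _ _ Fx))// ltry.
apply/cvg_ex; exists (L1Sum gs); apply/fcvgrPdist_lt => e e0.
have e20 : 0 < e / 2 by rewrite divr_gt0.
have [x Fx] := Fc _ e20; apply: filterS (Fx) => y; rewrite -ball_normE/= => xy.
rewrite (le_lt_trans (ler_distD x _ _))// [ltRHS]splitr ler_ltD// distrC.
by rewrite -lee_fin (l1_normE (x - L1Sum gs)); exact: gP.
Qed.

HB.instance Definition _ := Uniform_isComplete.Build l1_sum l1_complete.

Definition l1_proj (i : I) (x : l1_sum) : X i := x i.

Lemma l1_inj_esum (i : I) (v : X i) :
  (\esum_(k in setT) `|dfwith (fun k => 0 : X k) i v k|%:E = `|v|%:E)%E.
Proof.
rewrite -[in RHS](dfwithin (fun k => 0 : X k) v).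
rewrite -(esum_set1 (a := fun k => `|dfwith (fun k => 0 : X k) i v k|%:E))//.
rewrite [RHS]esum_mkcond; apply: eq_esum => k _; case: ifPn => //.
by move=> /negP; rewrite inE/= => /eqP ki; rewrite dfwithout ?normr0// eq_sym.
Qed.

Fact l1_inj_summable (i : I) (v : X i) :
  (\esum_(k in setT) `|dfwith (fun k => 0 : X k) i v k|%:E < +oo)%E.
Proof. by rewrite l1_inj_esum ltry. Qed.

Definition l1_inj (i : I) (v : X i) : l1_sum := L1Sum (l1_inj_summable v).

Lemma l1_inj_norm (i : I) (v : X i) : `|l1_inj v| = `|v|.
Proof. by apply: EFin_inj; rewrite (l1_normE (l1_inj v)) l1_inj_esum. Qed.

Definition proj_closure (D : set l1_sum) (i : I) : set (X i) :=
  closure (l1_proj i @` D).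

End l1_sum.

Arguments l1_proj {R I} X i x.
Arguments l1_inj {R I} X i v.
Arguments proj_closure {R I X} D i.

Definition convex_hull (R : realType) (X : normedModType R) (A : set X) :
  set X := smallest (@convex_set R X) A.

Definition closed_convex_hull (R : realType) (X : normedModType R)
    (A : set X) : set X := closure (convex_hull A).

Section Bishop_Phelps_Bollobas.
Variables (R : realType) (X Y : completeNormedModType R) (D : set X).

Definition BPBp_with (eta : R -> R) : Prop := forall eps, 0 < eps ->
  0 < eta eps /\
  forall (T : blop X Y) (x : X),
    norm_on D T = 1 -> D x -> 1 - eta eps < `|T x| ->
    exists (S : blop X Y) (z : X),
      [/\ D z, `|S z| = 1, norm_on D S = 1, `|x - z| < eps & `|T - S| < eps].

Definition BPBp : Prop := exists eta, BPBp_with eta.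

Definition BPB_Pi : set (X * blop X Y) :=
  [set p : X * blop X Y | [/\ D p.1, `|p.2 p.1| = 1 & norm_on D p.2 = 1]].

(* Extended-real valued, so that the infimum of the empty set is +oo. *)
Definition BPB_dist (x : X) (T : blop X Y) : \bar R :=
  ereal_inf [set (Num.max `|x - p.1| `|T - p.2|)%:E | p in BPB_Pi].

Definition BPB_eta (eps : R) : \bar R :=
  ereal_inf [set (1 - `|p.2 p.1|)%:E | p in
    [set p : X * blop X Y |
      [/\ D p.1, norm_on D p.2 = 1 & (eps%:E <= BPB_dist p.1 p.2)%E]]].

End Bishop_Phelps_Bollobas.

Arguments BPBp_with {R} X Y D eta.
Arguments BPBp {R} X Y D.
Arguments BPB_eta {R} X Y D eps.

(* Main.v *)
Require Import Defs.
From mathcomp Require Import all_boot all_order all_algebra.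
From mathcomp Require Import all_classical all_reals all_analysis.

Set Implicit Arguments.
Unset Strict Implicit.
Unset Printing Implicit Defensive.

Import Order.TTheory GRing.Theory Num.Theory.
Import numFieldNormedType.Exports.

Local Open Scope classical_set_scope.
Local Open Scope ring_scope.

(** Write [E_i], [P_i] for the embedding and projection of the [i]-th summand of
    [X], and [F_j], [Q_j] for those of the [j]-th factor of [Y].  An operator
    [T : X_i -> Y_j] is the corner of [T' = F_j T P_i : X -> Y].  Since
    [P_i D] is contained in [D_i] and [E_i D_i] in [D], the operators [T] and
    [T'] take the same norms on [D_i] and [D] ([norm_on_corner_extension]).
    Both conclusions follow once every pair [(z, S)] in [BPB_Pi D] with
    [d = `|T' - S| < 1] is shown to yield the pair [(P_i z, Q_j S E_i)] in
    [BPB_Pi D_i] ([corner_BPB_Pi]), because passing to corners does not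
    increase distances ([l1_proj_dist], [corner_dist]).

    The coordinates of [S z] other than the [j]-th one are those of [(S - T') z]
    and have norm at most [d < 1], so the norm of [S z], which is [1], is
    reached at the [j]-th coordinate ([linf_norm_attained]): with [U = Q_j S],
    [`|U z| = 1].  It remains to see that [z] lies in the [i]-th summand, i.e.
    that [V z = 0] for [V = id - E_i P_i].  The function
    [g w = `|U w| + (1 - d) * `|V w|] is convex and continuous.
    It is at most [1] on [E_i D_i], where [V] vanishes and [`|U w|] is bounded
    by [norm_on D S = 1]; it is at most [d + (1 - d) = 1] on [E_k D_k] for
    [k != i], where [T'] vanishes, so that [`|U w| <= d], while
    [`|V w| = `|w| <= 1].  As [D] is the closed convex hull of these sets,
    [g <= 1] on [D]; at [z] this reads [1 + (1 - d) * `|V z| <= 1], so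
    [V z = 0] ([attaining_point_in_block]).  Working with the norm of
    [U w] rather than with a functional attaining [`|U z|] makes the argument
    independent of the Hahn-Banach theorem. *)

(** * Bounded operators and norm sublevel sets *)

Section bounded_operator_facts.
Variable R : realType.

Lemma blop_normE (X Y : normedModType R) (T : blop X Y) : `|T| = opnorm T.
Proof. by []. Qed.

Lemma blop_continuous (X Y : normedModType R) (T : blop X Y) : continuous T.
Proof.
have [M TM] := blop_bounded T.
apply: (@bounded_linear_continuous _ _ _ (T : {linear X -> Y})).
apply/bounded_funP => r; exists (`|M| * r) => x xr.
rewrite (le_trans (TM x))// (le_trans (ler_wpM2r _ (ler_norm M)))//.
by rewrite ler_wpM2l.
Qed.

Lemma norm_on_ub (X Y : normedModType R) (D : set X) (T : blop X Y) x :
  D `<=` unit_ball X -> D x -> `|T x| <= norm_on D T.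
Proof.
move=> D1; apply: (@sup_image_ub _ _ D (fun y => `|T y|) (opnorm T)) => y /D1.
exact: opnorm_ub.
Qed.

Lemma norm_on_attained (X Y : normedModType R) (D : set X) (T : X -> Y) z M :
  D z -> `|T z| = M -> (forall x, D x -> `|T x| <= M) -> norm_on D T = M.
Proof.
move=> Dz Tz TM; apply/eqP; rewrite eq_le -{2}Tz (sup_image_ub TM Dz) andbT.
by apply: sup_image_le; rewrite // -Tz.
Qed.

Fact blop_id_linear (X : normedModType R) : linear (@idfun X).
Proof. by []. Qed.
Fact blop_id_bounded (X : normedModType R) :
  exists M : R, forall x : X, `|idfun x| <= M * `|x|.
Proof. by exists 1 => x; rewrite mul1r. Qed.
Definition blop_id (X : normedModType R) : blop X X :=
  Blop (@blop_id_linear X) (blop_id_bounded X).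

Section composition.
Variables (X Y Z : normedModType R) (S : blop Y Z) (T : blop X Y).

Fact blop_comp_linear : linear (S \o T).
Proof. by move=> a x y; rewrite /= !linearP. Qed.
Fact blop_comp_bounded : exists M : R, forall x, `|(S \o T) x| <= M * `|x|.
Proof.
have [M SM] := blop_bounded S; have [N TN] := blop_bounded T.
exists (`|M| * N) => x /=; rewrite (le_trans (SM _))//.
by rewrite (le_trans (ler_wpM2r _ (ler_norm M)))// -mulrA ler_wpM2l.
Qed.
Definition blop_comp := Blop blop_comp_linear blop_comp_bounded.

End composition.

Lemma closed_convex_hull_sub (X : normedModType R) (A B : set X) :
  closed B -> convex_set (M := X) B -> A `<=` B -> closed_convex_hull A `<=` B.
Proof.
move=> cB vB AB; rewrite [X in _ `<=` X](closure_id B).1//.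
by apply: closure_subset; exact: smallest_sub.
Qed.

Section sublevel.
Variables (X Y Z : normedModType R) (U : blop X Y) (V : blop X Z) (c M : R).

Let sublevel : set X := [set x | `|U x| + c * `|V x| <= M].

Lemma closed_norm_sublevel : closed sublevel.
Proof.
apply: (preimage_closed (f := fun x => `|U x| + c * `|V x|)
  (D := [set r : R | r <= M])) => [x _|]; last exact: closed_le.
apply: cvgD; first by apply: cvg_norm; exact: blop_continuous.
by apply: cvgM; [exact: cvg_cst|apply: cvg_norm; exact: blop_continuous].
Qed.

Lemma convex_norm_sublevel : 0 <= c -> convex_set (M := X) sublevel.
Proof.
move=> c0 x y t; rewrite !inE /sublevel/= => xM yM.
set a : R := t%:inum; have a0 : 0 <= a by rewrite /a.
have b0 : 0 <= 1 - a by rewrite subr_ge0 /a.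
change (`|U (a *: x + (1 - a) *: y)| + c * `|V (a *: x + (1 - a) *: y)| <= M).
have conv_le (W : normedModType R) (T : blop X W) :
    `|T (a *: x + (1 - a) *: y)| <= a * `|T x| + (1 - a) * `|T y|.
  rewrite linearD !linearZ/= (le_trans (ler_normD _ _))//.
  by rewrite !normrZ !ger0_norm.
rewrite (le_trans (lerD (conv_le _ U) (ler_wpM2l c0 (conv_le _ V))))//.
rewrite mulrDr !(mulrCA c) addrACA -!mulrDr.
have -> : M = a * M + (1 - a) * M by rewrite -mulrDl subrKC mul1r.
by rewrite lerD ?ler_wpM2l.
Qed.

End sublevel.

End bounded_operator_facts.

(** * Coordinate operators and corners *)

Section coordinate_operators.
Variables (R : realType) (I J : choiceType).
Variables (X : I -> completeNormedModType R) (Y : J -> completeNormedModType R).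

Lemma l1_inj_in i (v : X i) : l1_inj X i v i = v.
Proof. exact: dfwithin. Qed.

Lemma l1_inj_out i k (v : X i) : k != i -> l1_inj X i v k = 0.
Proof. by move=> ki; rewrite /= dfwithout// eq_sym. Qed.

Lemma l1_proj_dist i x (z : l1_sum X) : `|x - z i| <= `|l1_inj X i x - z|.
Proof.
apply: le_trans (l1_norm_ub _ i).
change (`|x - z i| <= `|l1_inj X i x i - z i|).
by rewrite l1_inj_in.
Qed.

Fact l1_proj_linear i : linear (l1_proj X i).
Proof. by []. Qed.
Fact l1_proj_bounded i : exists M : R, forall x, `|l1_proj X i x| <= M * `|x|.
Proof. by exists 1 => x; rewrite mul1r; exact: l1_norm_ub. Qed.
Definition l1_projop i : blop (l1_sum X) (X i) :=
  Blop (@l1_proj_linear i) (l1_proj_bounded i).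

Fact l1_inj_linear i : linear (l1_inj X i).
Proof.
move=> a x y; apply: l1_ext => k.
change (l1_inj X i (a *: x + y) k = a *: l1_inj X i x k + l1_inj X i y k).
have [->|ki] := eqVneq k i; first by rewrite !l1_inj_in.
by rewrite !l1_inj_out// scaler0 addr0.
Qed.
Fact l1_inj_bounded i : exists M : R, forall x, `|l1_inj X i x| <= M * `|x|.
Proof. by exists 1 => x; rewrite mul1r l1_inj_norm. Qed.
Definition l1_injop i : blop (X i) (l1_sum X) :=
  Blop (@l1_inj_linear i) (l1_inj_bounded i).

Definition linf_proj j (y : linf_sum Y) : Y j := y j.
Fact linf_proj_linear j : linear (@linf_proj j).
Proof. by []. Qed.
Fact linf_proj_bounded j :
  exists M : R, forall y, `|@linf_proj j y| <= M * `|y|.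
Proof. by exists 1 => y; rewrite mul1r; exact: linf_norm_ub. Qed.
Definition linf_projop j : blop (linf_sum Y) (Y j) :=
  Blop (@linf_proj_linear j) (linf_proj_bounded j).

Fact linf_inj_le j (v : Y j) k : `|dfwith (fun k => 0 : Y k) j v k| <= `|v|.
Proof.
by have [->|kj] := eqVneq k j; rewrite ?dfwithin// dfwithout ?normr0// eq_sym.
Qed.
Definition linf_inj j (v : Y j) : linf_sum Y :=
  LinfSum (ex_intro _ `|v| (linf_inj_le v)).

Lemma linf_inj_in j (v : Y j) : linf_inj v j = v.
Proof. exact: dfwithin. Qed.

Lemma linf_inj_out j k (v : Y j) : k != j -> linf_inj v k = 0.
Proof. by move=> kj; rewrite /= dfwithout// eq_sym. Qed.

Lemma linf_inj_norm j (v : Y j) : `|linf_inj v| = `|v|.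
Proof.
apply/eqP; rewrite eq_le; apply/andP; split.
  by apply: linf_norm_le => // k; exact: linf_inj_le.
by rewrite -{1}(linf_inj_in v); exact: linf_norm_ub.
Qed.

Fact linf_inj_linear j : linear (@linf_inj j).
Proof.
move=> a x y; apply: linf_ext => k.
change (linf_inj (a *: x + y) k = a *: linf_inj x k + linf_inj y k).
have [->|kj] := eqVneq k j; first by rewrite !linf_inj_in.
by rewrite !linf_inj_out// scaler0 addr0.
Qed.
Fact linf_inj_bounded j : exists M : R, forall x, `|@linf_inj j x| <= M * `|x|.
Proof. by exists 1 => x; rewrite mul1r linf_inj_norm. Qed.
Definition linf_injop j : blop (Y j) (linf_sum Y) :=
  Blop (@linf_inj_linear j) (linf_inj_bounded j).

Definition corner_extension i j (T : blop (X i) (Y j)) :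
  blop (l1_sum X) (linf_sum Y) :=
  blop_comp (linf_injop j) (blop_comp T (l1_projop i)).

Definition corner i j (S : blop (l1_sum X) (linf_sum Y)) : blop (X i) (Y j) :=
  blop_comp (linf_projop j) (blop_comp S (l1_injop i)).

(** If all coordinates but the [j]-th one stay below [d < 1], the supremum
    defining [`|y| = 1] is at most the maximum of [d] and [`|y j|]. *)
Lemma linf_norm_attained (y : linf_sum Y) j d : d < 1 ->
  `|y| = 1 -> (forall k, k != j -> `|y k| <= d) -> `|y j| = 1.
Proof.
move=> d1 y1 yd; apply/eqP; rewrite eq_le -{1}y1.
have -> : `|y j| <= `|y| by exact: linf_norm_ub.
rewrite leNgt; apply/negP => yj1.
suff : `|y| <= Num.max `|y j| d by rewrite y1 leNgt gt_max yj1 d1.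
apply: linf_norm_le => [|k]; first by rewrite le_max normr_ge0.
by have [->|/yd kd] := eqVneq k j; rewrite le_max ?lexx// kd orbT.
Qed.

Lemma corner_extension_norm_at i j (T : blop (X i) (Y j)) x :
  `|corner_extension T (l1_inj X i x)| = `|T x|.
Proof. by rewrite [LHS](linf_inj_norm (T (l1_inj X i x i))) l1_inj_in. Qed.

Lemma corner_dist i j (T : blop (X i) (Y j)) S :
  `|T - corner i j S| <= `|corner_extension T - S|.
Proof.
rewrite !blop_normE; apply: sup_image_le; first exact: opnorm_ge0.
move=> x x1; have Ex1 : unit_ball (l1_sum X) (l1_inj X i x).
  by rewrite /unit_ball/= l1_inj_norm.
apply: le_trans (opnorm_ub (corner_extension T - S) Ex1).
apply: le_trans (linf_norm_ub _ j).
rewrite [X in `|X| <= _](_ : _ = (corner_extension T - S) (l1_inj X i x) j)//.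
change (T x - S (l1_inj X i x) j =
  linf_inj (T (l1_inj X i x i)) j - S (l1_inj X i x) j).
by rewrite linf_inj_in l1_inj_in.
Qed.

(** * Norm attainment on a domain spanned by its blocks *)

Section block_domain.
Variable D : set (l1_sum X).
Hypothesis D1 : D `<=` unit_ball (l1_sum X).
Hypothesis Dhull : D = closed_convex_hull
  (\bigcup_(i in [set: I]) (l1_inj X i @` proj_closure D i)).

Lemma l1_inj_proj_closure i v : proj_closure D i v -> D (l1_inj X i v).
Proof.
move=> Dv; rewrite Dhull; apply: subset_closure; apply: sub_gen_smallest.
by exists i => //; exists v.
Qed.

Lemma proj_proj_closure i w : D w -> proj_closure D i (w i).
Proof. by move=> Dw; apply: subset_closure; exists w. Qed.

Lemma norm_on_corner_extension i j (T : blop (X i) (Y j)) :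
  norm_on D (corner_extension T) = norm_on (proj_closure D i) T.
Proof.
congr sup; apply/seteqP; split=> _ [w Dw <-].
  exists (w i); first exact: proj_proj_closure.
  by rewrite [RHS](linf_inj_norm (T (w i))).
exists (l1_inj X i w); first exact: l1_inj_proj_closure.
exact: corner_extension_norm_at.
Qed.

(** Mass of [z] outside the [i]-th summand would cost norm, as the other
    blocks contribute at most [d < 1]: the convex function
    [`|U w| + (1 - d) * `|V w|], with [V] the projection killing the [i]-th
    coordinate, is at most [1] on the generators of [D], hence on [D]. *)
Lemma attaining_point_in_block i j (S : blop (l1_sum X) (linf_sum Y)) z d :
  d < 1 -> norm_on D S = 1 -> D z -> `|S z j| = 1 ->
  (forall k v, k != i -> proj_closure D k v -> `|S (l1_inj X k v) j| <= d) ->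
  l1_inj X i (z i) = z.
Proof.
move=> d1 S1 Dz Sz Sd.
pose U := blop_comp (linf_projop j) S.
pose V := blop_id (l1_sum X) - blop_comp (l1_injop i) (l1_projop i).
have D_sub : D `<=` [set w | `|U w| + (1 - d) * `|V w| <= 1].
  rewrite {1}Dhull; apply: closed_convex_hull_sub.
  - exact: closed_norm_sublevel.
  - by apply: convex_norm_sublevel; rewrite subr_ge0 ltW.
  - move=> _ [k _ [v Dv <-]].
    have Dw := l1_inj_proj_closure Dv.
    change (`|U (l1_inj X k v)| + (1 - d) * `|V (l1_inj X k v)| <= 1).
    have [ki|ki] := eqVneq k i.
      subst k; have -> : V (l1_inj X i v) = 0.
        change (l1_inj X i v - l1_inj X i (l1_inj X i v i) = 0).
        by rewrite l1_inj_in subrr.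
      rewrite normr0 mulr0 addr0 -S1.
      by apply: le_trans (norm_on_ub S D1 Dw); exact: linf_norm_ub.
    have -> : V (l1_inj X k v) = l1_inj X k v.
      change (l1_inj X k v - l1_injop i (l1_inj X k v i) = l1_inj X k v).
      by rewrite l1_inj_out 1?eq_sym// linear0 subr0.
    rewrite -[leRHS](subrKC d) lerD//; first exact: Sd.
    by rewrite ler_piMr ?subr_ge0 ?(ltW d1)//; exact: (D1 Dw).
have := D_sub _ Dz; rewrite [X in X -> _]/= [`|U z|]Sz gerDl pmulr_rle0 ?subr_gt0//.
by rewrite normr_le0 => /eqP Vz; apply/esym/eqP; rewrite -subr_eq0; apply/eqP.
Qed.

(** The extension of [T] vanishes off the [i]-th summand and has no coordinate
    off [j]; there [S] coincides with minus the error
    [corner_extension T - S], whose norm is below [1]. *)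
Lemma corner_BPB_Pi i j (T : blop (X i) (Y j)) z
    (S : blop (l1_sum X) (linf_sum Y)) :
  BPB_Pi D (z, S) -> `|corner_extension T - S| < 1 ->
  BPB_Pi (proj_closure D i) (z i, corner i j S).
Proof.
set d := `|_ - S| => -[/= Dz Sz S1] d1.
have TSd w : D w -> `|(corner_extension T - S) w| <= d.
  by move=> /D1; exact: opnorm_ub.
have Szj : `|S z j| = 1.
  apply: (linf_norm_attained d1 Sz) => k kj.
  apply: le_trans (TSd _ Dz); apply: le_trans (linf_norm_ub _ k).
  change (`|S z k| <= `|linf_inj (T (z i)) k - S z k|).
  by rewrite linf_inj_out// sub0r normrN.
have zE : l1_inj X i (z i) = z.
  apply: (attaining_point_in_block d1 S1 Dz Szj) => k v ki Dv.
  apply: le_trans (TSd _ (l1_inj_proj_closure Dv)).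
  apply: le_trans (linf_norm_ub _ j).
  change (`|S (l1_inj X k v) j| <=
    `|linf_inj (T (l1_inj X k v i)) j - S (l1_inj X k v) j|).
  by rewrite l1_inj_out 1?eq_sym// linear0 linf_inj_in sub0r normrN.
have Dzi : proj_closure D i (z i) by exact: proj_proj_closure.
have Czi : `|corner i j S (z i)| = 1.
  by change (`|S (l1_inj X i (z i)) j| = 1); rewrite zE.
split => //=; apply: (norm_on_attained Dzi Czi) => x Dx.
rewrite -S1; apply: le_trans (norm_on_ub S D1 (l1_inj_proj_closure Dx)).
exact: linf_norm_ub.
Qed.

(** A pair of [BPB_Pi D] closer than [eps] to the extended pair would have a
    corner in [BPB_Pi (proj_closure D i)] closer than [eps] to [(x, T)]. *)
Lemma BPB_dist_corner_extension i j (T : blop (X i) (Y j)) x eps : eps < 1 ->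
  (eps%:E <= BPB_dist (proj_closure D i) x T)%E ->
  (eps%:E <= BPB_dist D (l1_inj X i x) (corner_extension T))%E.
Proof.
move=> eps1 epsT; apply: le_ereal_inf_tmp => _ [[z S] PS <-] /=.
rewrite lee_fin leNgt; apply/negP; rewrite gt_max => /andP[xz TS].
have PC := corner_BPB_Pi PS (lt_trans TS eps1).
have : (eps%:E <= (Num.max `|x - z i| `|T - corner i j S|)%:E)%E.
  apply: le_trans epsT _; apply: ereal_inf_lbound.
  by exists (z i, corner i j S).
rewrite lee_fin leNgt gt_max => /negP; apply.
by rewrite (le_lt_trans (l1_proj_dist _ _))// (le_lt_trans (corner_dist _ _)).
Qed.

End block_domain.

End coordinate_operators.

Theorem proposition4p2 (R : realType) (I J : choiceType)
    (X : I -> completeNormedModType R) (Y : J -> completeNormedModType R)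
    (D : set (l1_sum X)) :
  bounded_set D -> closed D -> convex_set (M := l1_sum X) D ->
  D `<=` unit_ball (l1_sum X) ->
  D = closed_convex_hull
        (\bigcup_(i in [set: I]) (l1_inj X i @` proj_closure D i)) ->
  (forall eta : R -> R, BPBp_with (l1_sum X) (linf_sum Y) D eta ->
     forall (i : I) (j : J), BPBp (X i) (Y j) (proj_closure D i)) /\
  (forall eps : R, 0 < eps < 1 -> forall (i : I) (j : J),
     (BPB_eta (l1_sum X) (linf_sum Y) D eps <=
      BPB_eta (X i) (Y j) (proj_closure D i) eps)%E).
Proof.
move=> _ _ _ D1 Dhull; split=> [eta etaP i j|eps /andP[_ eps1] i j].
  (* The corner argument needs an approximation error below 1, so [eta] is
     read at a radius capped by 1 / 2. *)
  exists (fun eps => eta (Num.min eps (1 / 2))) => eps eps0.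
  set e := Num.min eps _.
  have e0 : 0 < e by rewrite lt_min eps0 divr_gt0.
  have e1 : e < 1 by rewrite gt_min ltr_pdivrMr// mul1r ltr1n orbT.
  have e_le : e <= eps by rewrite ge_min lexx.
  have [eta0 etaT] := etaP e e0; split=> // T x T1 Dx Tx.
  have [||S [z [Dz Sz S1 xz TS]]] :=
      etaT (corner_extension T) (l1_inj X i x) _ (l1_inj_proj_closure Dhull Dx).
  - by rewrite norm_on_corner_extension.
  - by rewrite corner_extension_norm_at.
  have [/= Dzi Czi C1] := corner_BPB_Pi D1 Dhull (And3 Dz Sz S1 : BPB_Pi D (z, S))
    (lt_trans TS e1).
  exists (corner i j S), (z i); split => //.
    by rewrite (le_lt_trans (l1_proj_dist _ _))// (lt_le_trans xz).
  by rewrite (le_lt_trans (corner_dist _ _))// (lt_le_trans TS).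
apply: le_ereal_inf_tmp => _ [[x T] [/= Dx T1 epsT] <-].
apply: ereal_inf_lbound; exists (l1_inj X i x, corner_extension T) => /=.
  split => /=; first exact: l1_inj_proj_closure.
  - by rewrite norm_on_corner_extension.
  - exact: BPB_dist_corner_extension.
by rewrite corner_extension_norm_at.
Qed.
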